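(* For every integer $q\geq 2$ there exists a group $G$ which is not nilpotent of class $\leq q$, but for which $\mathscr{C}(\mathcal{N}_{q+1},G)$ is simply-connected. In other words, for every $q\ge 2$ the assertion ''for every group $G$, $\mathscr{C}(\mathcal{N}_{q+1},G)$ is simply-connected if and only if $G$ is nilpotent of class $\leq q$'' is false.
   Context: For a group $G$ and a family $\mathcal{F}$ of subgroups of $G$, the coset poset $\mathscr{C}(\mathcal{F},G)$ is the set of left cosets $\{gH\mid g\in G,\ H\in\mathcal{F}\}$ partially ordered by inclusion; the same symbol denotes the geometric realization of its order complex (the simplicial complex whose $n$-simplices are the strictly increasing chains of $n+1$ cosets). $\mathcal{N}_{q+1}$ denotes the family of all subgroups of $G$ that are nilpotent of class at most $q$. By a theorem of Abels and Holz, the fundamental group of $\mathscr{C}(\mathcal{N}_{q+1},G)$ is the kernel of the canonical map $\operatorname{colim}_{H\in\mathcal{N}_{q+1}}H\to G$, so simple connectivity expresses that $G$ is the amalgamated product of its nilpotent subgroups of class $\leq q$ along their intersections. *)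

(* Defs.v *)
From HB Require Import structures.
From mathcomp Require Import all_boot all_order all_algebra.
From mathcomp Require Import all_classical all_reals all_analysis.

Set Implicit Arguments.
Unset Strict Implicit.
Unset Printing Implicit Defensive.

Import Order.TTheory GRing.Theory Num.Theory.
Import numFieldNormedType.Exports.

Local Open Scope classical_set_scope.
Local Open Scope ring_scope.

Section Groups.
Variable G : groupType.
Implicit Types H A : set G.

Definition is_subgroup H : Prop :=
  [/\ H 1%g, (forall x y, H x -> H y -> H (x * y)%g)
    & (forall x, H x -> H (x^-1)%g)].

(* The terms are indexed from 0: [lower_central H n] is the term usually
   written Gamma^(n+1) or L_(n+1), so that [lower_central H 0 = H]. *)
Fixpoint lower_central H (n : nat) : set G :=
  if n is m.+1 then
    smallest is_subgroup
      [set commg x y | x in lower_central H m & y in H]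
  else H.

Definition nilpotent_class_le (q : nat) H : Prop :=
  lower_central H q = [set 1%g].

(* The family N_(q+1). *)
Definition nilpotent_subgroups (q : nat) : set (set G) :=
  [set H | is_subgroup H /\ nilpotent_class_le q H].

Definition left_coset (g : G) H : set G := [set (g * h)%g | h in H].

Definition coset_poset (F : set (set G)) : set (set G) :=
  [set left_coset g H | g in [set: G] & H in F].

End Groups.

(* A simplicial complex on the vertex type T is given by its set of simplices;
   an n-simplex x_0 < ... < x_n is encoded as the set {x_0, ..., x_n}. *)
Definition order_complex (T : Type) (le : T -> T -> Prop) (P : set T)
    : set (set T) :=
  [set s | [/\ finite_set s, s !=set0, s `<=` P & total_on s le]].

(* A point of the geometric realization is given by its barycentric
   coordinates. When all simplices of K are finite, as is the case for order
   complexes, the sum below is a finite sum. *)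
Record realization (R : realType) (V : choiceType) (K : set (set V)) :=
  Realization {
    bary :> V -> R;
    bary_ge0 : forall v, 0 <= bary v;
    bary_simplex : K [set v | bary v != 0];
    bary_sum1 : \sum_(v \in [set: V]) bary v = 1
  }.
Arguments realization : clear implicits.

Section RealizationTopology.
Variables (R : realType) (V : choiceType) (K : set (set V)).
Let X := realization R V K.

HB.instance Definition _ := gen_eqMixin X.
HB.instance Definition _ := gen_choiceMixin X.

Definition closed_simplex (s : set V) : set X :=
  [set x : X | [set v | x v != 0] `<=` s].

(* The weak (coherent) topology: U is open iff its trace on every closed simplex
   is open for the Euclidean topology of that simplex, given here by the
   sup distance between barycentric coordinates. *)
Definition weak_open (U : set X) : Prop :=
  forall s, K s -> forall x, closed_simplex s x -> U x ->
  exists2 e : R, 0 < e &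
    forall y, closed_simplex s y ->
      (forall v, s v -> `|x v - y v| < e) -> U y.

Lemma weak_openT : weak_open setT.
Proof. by move=> s _ x _ _; exists 1. Qed.

Lemma weak_openI U U' : weak_open U -> weak_open U' -> weak_open (U `&` U').
Proof.
move=> oU oU' s Ks x sx [Ux U'x].
have [e e0 eU] := oU s Ks x sx Ux.
have [e' e'0 eU'] := oU' s Ks x sx U'x.
exists (Num.min e e'); first by rewrite lt_min e0.
move=> y sy xy; split.
  by apply: eU => // v /xy; rewrite lt_min => /andP[].
by apply: eU' => // v /xy; rewrite lt_min => /andP[].
Qed.

Lemma weak_open_bigU (I : Type) (F : I -> set X) :
  (forall i, weak_open (F i)) -> weak_open (\bigcup_i F i).
Proof.
move=> oF s Ks x sx [i _ Fix].
have [e e0 eF] := oF i s Ks x sx Fix.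
by exists e => // y sy xy; exists i => //; exact: eF.
Qed.

HB.instance Definition _ :=
  isOpenTopological.Build X weak_openT weak_openI weak_open_bigU.

End RealizationTopology.

Section SimplyConnected.
Variables (R : realType) (T : topologicalType).

Definition is_path (f : R -> T) : Prop := {within `[0, 1], continuous f}.

Definition path_connected : Prop :=
  forall x y : T, exists f : R -> T, [/\ is_path f, f 0 = x & f 1 = y].

Definition null_homotopic (f : R -> T) : Prop :=
  exists h : R * R -> T,
  [/\ {within `[0, 1] `*` `[0, 1], continuous h},
      {in `[0, 1], forall t, h (0, t) = f t},
      {in `[0, 1], forall t, h (1, t) = f 0}
    & {in `[0, 1], forall s, h (s, 0) = f 0 /\ h (s, 1) = f 0}].

Definition simply_connected : Prop :=
  [/\ [set: T] !=set0, path_connected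
    & forall f : R -> T, is_path f -> f 0 = f 1 -> null_homotopic f].

End SimplyConnected.

Definition coset_space (R : realType) (G : groupType) (F : set (set G))
    : topologicalType :=
  realization R (set G) (order_complex (@subset G) (coset_poset F)).

(* Main.v *)
Require Import Defs.
From HB Require Import structures.
From mathcomp Require Import all_boot all_order all_algebra.
From mathcomp Require Import all_classical all_reals all_analysis.
From mathcomp Require Import finmap lra.

(** The group is the wreath product [G = A x| E] of Z/2 with [E = (Z/2)^(q+1)],
    where [A] is the group of functions from [E] to Z/2.  Every [e] in [E] is an
    involution, so [(e - 1)^2] kills [A] and the subgroup generated by [A] and
    [e] has class at most 2; [A] and [E] are abelian.  The relations defining
    [G] as a semidirect product thus all hold inside subgroups of class at most
    2, which makes the coset poset simply connected.  On the other hand the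
    function [x_0 ... x_q] is differentiated by the unit vectors, one variable
    at a time, into [x_q], so [G] is not nilpotent of class at most [q].

    Since [G] is finite, so is the order complex, and its weak topology is the
    topology of barycentric coordinates.  Simple connectivity is obtained by
    choosing a path c(x) from a base point to every point x, in such a way that
    c is locally compatible with paths: any path f then satisfies
    c(f 0) . f ~ c(f 1), so that loops are null-homotopic.  To define c it is
    enough to choose, for every vertex, an edge path from the base vertex,
    compatibly with edges up to homotopy.  The vertex {ae} is reached through
    {1}, A, {a}, aE, {ae}. *)

Set Implicit Arguments.
Unset Strict Implicit.
Unset Printing Implicit Defensive.

Import Order.TTheory GRing.Theory Num.Theory.
Import numFieldNormedType.Exports.

Local Open Scope classical_set_scope.

(** * Continuity of expressions built from basic operations *)

Section ContinuityRules.
Local Open Scope ring_scope.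
Variable R : realType.

Lemma cont_comp (S U W : topologicalType) (f : S -> U) (g : U -> W) :
  continuous f -> continuous g -> continuous (fun x => g (f x)).
Proof. by move=> cf cg x; apply: continuous_comp; [exact: cf|exact: cg]. Qed.

Lemma cont_pair (S U W : topologicalType) (f : S -> U) (g : S -> W) :
  continuous f -> continuous g -> continuous (fun x => (f x, g x)).
Proof. by move=> cf cg x; apply: cvg_pair; [apply: cf|apply: cg]. Qed.

Lemma cont_fst (S U : topologicalType) : continuous (@fst S U).
Proof. by move=> x; apply: cvg_fst. Qed.

Lemma cont_snd (S U : topologicalType) : continuous (@snd S U).
Proof. by move=> x; apply: cvg_snd. Qed.

Lemma cont_add (S : topologicalType) (f g : S -> R) :
  continuous f -> continuous g -> continuous (fun x => f x + g x).
Proof. by move=> cf cg x; apply: cvgD; [apply: cf|apply: cg]. Qed.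

Lemma cont_mul (S : topologicalType) (f g : S -> R) :
  continuous f -> continuous g -> continuous (fun x => f x * g x).
Proof. by move=> cf cg x; apply: cvgM; [apply: cf|apply: cg]. Qed.

Lemma cont_opp (S : topologicalType) (f : S -> R) :
  continuous f -> continuous (fun x => - f x).
Proof. by move=> cf x; apply: cvgN; apply: cf. Qed.

Lemma cont_cst (S U : topologicalType) (k : U) : continuous (fun _ : S => k).
Proof. by move=> x; apply: cvg_cst. Qed.

Lemma cont_norm (S : topologicalType) (f : S -> R) :
  continuous f -> continuous (fun x => `|f x|).
Proof. by move=> cf x; apply: cvg_norm; apply: cf. Qed.

Lemma cont_min (S : topologicalType) (f g : S -> R) :
  continuous f -> continuous g -> continuous (fun x => Num.min (f x) (g x)).
Proof. by move=> cf cg x; apply: continuous_min; [apply: cf|apply: cg]. Qed.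

Lemma cont_max (S : topologicalType) (f g : S -> R) :
  continuous f -> continuous g -> continuous (fun x => Num.max (f x) (g x)).
Proof. by move=> cf cg x; apply: continuous_max; [apply: cf|apply: cg]. Qed.

Lemma cont_id (S : topologicalType) : continuous (fun x : S => x).
Proof. by move=> x; apply: cvg_id. Qed.

End ContinuityRules.

Ltac cont := lazymatch goal with |- forall x, @continuous_at _ _ x ?F =>
  lazymatch F with
  | (fun _ => ?k) => exact: cont_cst
  | (fun x => x) => exact: cont_id
  | (fun x => (@?f x + @?g x)%R) => apply: cont_add; cont
  | (fun x => (@?f x * @?g x)%R) => apply: cont_mul; cont
  | (fun x => (- @?f x)%R) => apply: cont_opp; cont
  | (fun x => (`|@?f x|)%R) => apply: cont_norm; cont
  | (fun x => Num.min (@?f x) (@?g x)) => apply: cont_min; cont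
  | (fun x => Num.max (@?f x) (@?g x)) => apply: cont_max; cont
  | (fun x => (@?f x, @?g x)) => apply: cont_pair; cont
  | _ => first [exact: cont_fst | exact: cont_snd | exact: cont_id
              | exact: cont_cst | apply: cont_max; cont | apply: cont_opp; cont
              | apply: cont_add; cont | apply: cont_mul; cont | idtac]
  end end.

(** * Homotopy of paths relative to endpoints *)

Section PathHomotopy.
Local Open Scope ring_scope.
Variables (R : realType) (T : topologicalType).
Implicit Types (f g p q r : R -> T).

(** Pasting lemma: where [c] is nonzero a single branch is used throughout a neighbourhood, and
    where it vanishes both branches tend to the same value. *)
Lemma continuous_if_le0 (S : topologicalType) (c : S -> R) (f g : S -> T) :
  continuous c -> continuous f -> continuous g ->
  (forall x, c x = 0 -> f x = g x) ->
  continuous (fun x => if c x <= 0 then f x else g x).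
Proof.
move=> cc cf cg fg x; have [cx|cx|cx] := ltgtP (c x) 0.
- rewrite /continuous_at (ltW cx); apply: cvg_trans (cf x); apply: near_eq_cvg.
  have H : \forall y \near x, c y < 0 := cc x _ (lt_nbhsl cx).
  by apply: filterS H => y /= /ltW ->.
- rewrite /continuous_at leNgt cx /=; apply: cvg_trans (cg x); apply: near_eq_cvg.
  have H : \forall y \near x, 0 < c y := cc x _ (lt_nbhsr cx).
  by apply: filterS H => y /=; rewrite ltNge => /negbTE ->.
- rewrite /continuous_at cx lexx => A Afx.
  have Agx : nbhs (g x) A by rewrite -fg.
  have H : \forall y \near x, A (f y) /\ A (g y).
    by apply: filterI; [exact: cf|exact: cg].
  change (\forall y \near x, A (if c y <= 0 then f y else g y)).
  by apply: filterS H => y [fy gy]; case: ifP.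
Qed.

(** Paths and homotopies live on the whole line and plane, so that no subspace topology enters;
    [clamp] gives the passage to the unit interval. *)
Definition phom f g := exists h : R * R -> T,
  [/\ continuous h, forall t, h (0, t) = f t, forall t, h (1, t) = g t
    & forall s, h (s, 0) = f 0 /\ h (s, 1) = f 1].

Definition clamp (t : R) : R := Num.min 1 (Num.max 0 t).

Definition pcat p q (t : R) :=
  if t + t - 1 <= 0 then p (t + t) else q (t + t - 1).

Lemma cont_clamp : continuous clamp.
Proof. by rewrite /clamp; cont. Qed.

Lemma clamp_itv t : 0 <= clamp t <= 1.
Proof. by rewrite /clamp le_min ge_min le_max !lexx ler01. Qed.

Lemma clampE t : 0 <= t <= 1 -> clamp t = t.
Proof. by move=> /andP[t0 t1]; rewrite /clamp max_r// min_r. Qed.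

Lemma clamp0 : clamp 0 = 0. Proof. by rewrite clampE// lexx ler01. Qed.
Lemma clamp1 : clamp 1 = 1. Proof. by rewrite clampE// lexx ler01. Qed.

Lemma phom_refl f : continuous f -> phom f f.
Proof.
by move=> cf; exists (fun z => f z.2); split=> //; apply: cont_comp cf; cont.
Qed.

Lemma phom_sym f g : phom f g -> phom g f.
Proof.
move=> [h [ch h0 h1 hs]]; exists (fun z => h (1 - z.1, z.2)); split=> /=.
- by apply: cont_comp ch; apply: cont_pair; cont.
- by move=> t; rewrite subr0.
- by move=> t; rewrite subrr.
- by move=> s; have [-> ->] := hs (1 - s); rewrite -!h1; have [-> ->] := hs 1.
Qed.

Lemma phom_trans g f p : phom f g -> phom g p -> phom f p.
Proof.
move=> [h [ch h0 h1 hs]] [k [ck k0 k1 ks]].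
exists (fun z => if z.1 + z.1 - 1 <= 0 then h (z.1 + z.1, z.2)
                 else k (z.1 + z.1 - 1, z.2)); split=> /=.
- apply: continuous_if_le0 => [||| [s t]/= st].
  + by cont.
  + by apply: cont_comp ch; apply: cont_pair; cont.
  + by apply: cont_comp ck; apply: cont_pair; cont.
  + by rewrite st k0; have -> : s + s = 1 by lra.
- by move=> t; rewrite ifT ?addr0//; lra.
- by move=> t; rewrite ifF ?addrK//; lra.
- move=> s; have [] := ks (s + s - 1); have [-> ->] := hs (s + s).
  by rewrite -!h1; have [-> ->] := hs 1; move=> -> ->; rewrite !if_same.
Qed.

(** The parameters [a] and [b] are joined by a straight-line homotopy in the line, which is then
    composed with [f]. The groupoid laws for paths below are all instances. *)
Lemma phom_reparam f (a b : R -> R) : continuous f ->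
  continuous a -> continuous b -> a 0 = b 0 -> a 1 = b 1 ->
  phom (f \o a) (f \o b).
Proof.
move=> cf ca cb ab0 ab1; exists (fun z => f ((1 - z.1) * a z.2 + z.1 * b z.2)).
split=> /=.
- apply: cont_comp cf; cont; [apply: cont_comp ca|apply: cont_comp cb]; cont.
- by move=> t; congr f; lra.
- by move=> t; congr f; lra.
- by move=> s; rewrite -ab0 -ab1; split; congr f; lra.
Qed.

Lemma phom_clamp f : continuous f -> phom f (f \o clamp).
Proof.
move=> cf; apply: (@phom_reparam f id clamp) => //; [|exact: cont_clamp|..].
- exact: cont_id.
- by rewrite clamp0.
- by rewrite clamp1.
Qed.

Lemma pcat_cont p q : continuous p -> continuous q -> p 1 = q 0 ->
  continuous (pcat p q).
Proof.
move=> cp cq pq; apply: continuous_if_le0.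
- by cont.
- by apply: cont_comp cp; cont.
- by apply: cont_comp cq; cont.
- by move=> t t0; rewrite t0 -pq; congr p; lra.
Qed.

Lemma pcat0 p q : pcat p q 0 = p 0.
Proof. by rewrite /pcat ifT ?addr0//; lra. Qed.

Lemma pcat1 p q : pcat p q 1 = q 1.
Proof. by rewrite /pcat ifF ?addrK//; lra. Qed.

Lemma phom_cat p p' q q' : phom p p' -> phom q q' -> p 1 = q 0 ->
  phom (pcat p q) (pcat p' q').
Proof.
move=> [h [ch h0 h1 hs]] [k [ck k0 k1 ks]] pq.
exists (fun z => if z.2 + z.2 - 1 <= 0 then h (z.1, z.2 + z.2)
                 else k (z.1, z.2 + z.2 - 1)); split=> /=.
- apply: continuous_if_le0 => [||| [s t]/= st].
  + by cont.
  + by apply: cont_comp ch; apply: cont_pair; cont.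
  + by apply: cont_comp ck; apply: cont_pair; cont.
  + have -> : t + t = 1 by lra.
    by rewrite subrr (hs s).2 (ks s).1.
- by move=> t; rewrite h0 k0.
- by move=> t; rewrite h1 k1.
- move=> s; rewrite pcat0 pcat1 ifT ?addr0 ?(hs s).1; last by lra.
  by rewrite ifF ?addrK ?(ks s).2//; lra.
Qed.

Lemma phom_catA p q r : continuous p -> continuous q -> continuous r ->
  p 1 = q 0 -> q 1 = r 0 ->
  phom (pcat (pcat p q) r) (pcat p (pcat q r)).
Proof.
move=> cp cq cr pq qr.
(* [F] runs through [p], [q], [r] on three successive unit intervals; the two bracketings are [F]
   composed with piecewise linear maps from 0 to 3. *)
pose F t := if t - 1 <= 0 then p t else
            if t - 2 <= 0 then q (t - 1) else r (t - 2).
have cF : continuous F.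
  apply: continuous_if_le0 => //; first by cont.
    apply: continuous_if_le0 => //; first by cont.
    - by apply: cont_comp cq; cont.
    - by apply: cont_comp cr; cont.
    - by move=> t t0; rewrite t0 -qr; congr q; lra.
  move=> t t0; rewrite t0 -pq ifT; first by congr p; lra.
  by lra.
pose a t : R := Num.min (4 * t) (2 * t + 1).
pose b t : R := Num.max (2 * t) (4 * t - 1).
have -> : pcat (pcat p q) r = F \o a.
  clear cF pq qr; apply/funext => t /=; rewrite /F /a /pcat.
  case: (leP (4 * t)) => t1;
    do ?case: ifP => ?; first [exfalso; lra|congr p; lra|congr q; lra|congr r; lra].
have -> : pcat p (pcat q r) = F \o b.
  clear cF pq qr; apply/funext => t /=; rewrite /F /b /pcat.
  case: (leP (2 * t)) => t1;
    do ?case: ifP => ?; first [exfalso; lra|congr p; lra|congr q; lra|congr r; lra].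
apply: phom_reparam => //; rewrite /a /b; do ?by cont.
- by rewrite !mulr0 add0r sub0r min_l ?max_l; lra.
- by rewrite !mulr1 min_r ?max_r; lra.
Qed.

Lemma phom_cst_cat p : continuous p -> phom (pcat (fun=> p 0) p) p.
Proof.
move=> cp; pose a t : R := Num.max 0 (2 * t - 1).
have -> : pcat (fun=> p 0) p = p \o a.
  apply/funext => t /=; rewrite /pcat /a.
  by case: (leP 0) => t1; do ?case: ifP => ?; congr p; lra.
apply: (@phom_reparam p a id) => //; rewrite /a; do ?by cont.
- by rewrite max_l; lra.
- by rewrite max_r; lra.
Qed.

Lemma phom_rev_cat p : continuous p ->
  phom (pcat (fun t => p (1 - t)) p) (fun=> p 1).
Proof.
(* The parameter goes from 1 to 0 and back to 1, so it deforms to the constant 1. *)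
move=> cp; pose a t : R := `|2 * t - 1|.
have -> : pcat (fun t => p (1 - t)) p = p \o a.
  apply/funext => t /=; rewrite /pcat /a.
  by case: (ger0P (2 * t - 1)) => t1; do ?case: ifP => ?; congr p; lra.
apply: (@phom_reparam p a (fun=> 1)) => //; rewrite /a; do ?by cont.
- by rewrite mulr0 sub0r normrN1.
- by rewrite mulr1 ger0_norm; lra.
Qed.

(** * Simple connectivity from a locally compatible choice of paths *)

Section LocalSystem.
Variables (b : T) (G : T -> R -> T).
Hypothesis Gcont : forall x, continuous (G x).
Hypothesis G0 : forall x, G x 0 = b.
Hypothesis G1 : forall x, G x 1 = x.
Hypothesis Gloc : forall x : T, exists2 U : set T, nbhs x U &
  forall p, continuous p -> (forall t, U (p t)) ->
    phom (pcat (G (p 0)) p) (G (p 1)).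

(** The claim for [f] cut off at time t defines a subset of the line which contains 0 and is open
    and closed, hence is everything by connectedness. *)
Lemma local_system_loop f : continuous f ->
  phom (pcat (G (f 0)) f) (G (f 1)).
Proof.
move=> cf.
pose fr (t t' : R) (s : R) := f (t + s * (t' - t)).
have cfr t t' : continuous (fr t t') by apply: cont_comp cf; cont.
pose P (t : R) := phom (pcat (G (f 0)) (fr 0 t)) (G (f t)).
have fr0 t t' : fr t t' 0 = f t by rewrite /fr mul0r addr0.
have fr1 t t' : fr t t' 1 = f t' by rewrite /fr; congr f; lra.
have step t t' : P t -> phom (pcat (G (f t)) (fr t t')) (G (f t')) -> P t'.
  move=> Pt Gt; rewrite /P; apply: phom_trans Gt.
  have h1 : phom (pcat (fr 0 t) (fr t t')) (fr 0 t').
    (* [a] goes affinely from 0 to t, then from t to t', in whatever order these lie. *)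
    pose a s : R := t * Num.min (2 * s) 1 + (t' - t) * Num.max 0 (2 * s - 1).
    have -> : pcat (fr 0 t) (fr t t') = f \o a.
      apply/funext => s; rewrite /pcat /fr /a /=.
      case: (leP (2 * s) 1) => s1; case: (leP 0 (2 * s - 1)) => s2;
        case: ifP => s3; congr f; try lra.
      have -> : s = 1 / 2 by lra.
      by lra.
    apply: (@phom_reparam f a (fun s => 0 + s * (t' - 0))) => //; rewrite /a.
    - by cont.
    - by cont.
    - by rewrite min_l ?max_l; lra.
    - by rewrite min_r ?max_r; lra.
  apply: phom_trans (phom_cat Pt (phom_refl (cfr t t')) _); last first.
    by rewrite pcat1 fr1 fr0.
  apply: phom_trans (phom_sym (phom_catA _ _ _ _ _)); rewrite ?G1 ?fr0 ?fr1//.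
  apply: phom_cat (phom_sym h1) _ => //; last by rewrite G1 fr0.
  exact: phom_refl.
have [PC PO] : closed (P : set R) /\ open (P : set R).
  (* Near [t0] the property passes between any two points; taking one of them to be [t0] gives
     openness, and taking the other gives closedness. *)
  have loc t0 : exists2 e : R, 0 < e &
      forall t t', `|t0 - t| < e -> `|t0 - t'| < e -> P t -> P t'.
    have [U Ux HU] := Gloc (f t0).
    have /nbhs_ballP[e /= e0 eU] := cf t0 U Ux.
    exists e => // t t' te te' /step; apply.
    (* Only the part of [fr t t'] over the unit interval is sure to stay in [U], so the parameter is
       clamped before the local hypothesis is applied. *)
    have cfc : continuous (fr t t' \o clamp).
      by apply: cont_comp (cfr t t'); exact: cont_clamp.
    have := HU (fr t t' \o clamp) cfc; rewrite /= clamp0 clamp1 fr0 fr1.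
    move=> Hc; apply: phom_trans (Hc _) => [|s].
      apply: phom_cat; [exact: phom_refl|exact: phom_clamp|by rewrite G1 fr0].
    apply: eU; rewrite /ball /=; have /andP[] := clamp_itv s.
    move: (clamp s) => {}s s0 s1.
    have -> : t0 - (t + s * (t' - t)) = (1 - s) * (t0 - t) + s * (t0 - t') by lra.
    apply: le_lt_trans (ler_normD _ _) _; rewrite !normrM.
    rewrite (ger0_norm s0) (@ger0_norm _ (1 - s)) ?subr_ge0//.
    have [->|sn0] := eqVneq s 0; first by lra.
    have s0' : 0 < s by rewrite lt_neqAle eq_sym sn0.
    by nra.
  split.
    rewrite -(setCK (P : set R)); apply: open_closedC; rewrite openE => t0 Pt0.
    have [e e0 H] := loc t0; apply/nbhs_ballP; exists e => //= t te Pt.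
    by apply: Pt0; apply: H Pt => //; rewrite subrr normr0.
  rewrite openE => t0 Pt0.
  have [e e0 H] := loc t0; apply/nbhs_ballP; exists e => //= t te.
  by apply: H Pt0 => //; rewrite subrr normr0.
have P0 : P 0.
  rewrite /P; have [U Ux HU] := Gloc (f 0).
  have := HU (fun=> f 0) (@cont_cst _ _ _) (fun=> nbhs_singleton Ux).
  suff -> : fr 0 0 = fun=> f 0 by [].
  by apply/funext => s; rewrite /fr subrr mulr0 addr0.
have P1 : P 1.
  have cT : connected [set: R] by apply/connected_intervalP => x y _ _ z.
  have : [set: R] `<=` P.
    rewrite -(cT (P : set R)) //; first by exists 0.
    - by exists P => //; rewrite setTI.
    - by exists P => //; rewrite setTI.
  exact.
have fr01 : fr 0 1 = f by apply/funext => s; rewrite /fr; congr f; lra.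
by move: P1; rewrite /P fr01.
Qed.

Lemma local_system_simply_connected : simply_connected R T.
Proof.
split; first by exists b.
  move=> x y; exists (pcat (fun t => G x (1 - t)) (G y)); split.
  - apply: continuous_subspaceT; apply: pcat_cont; rewrite ?subrr ?G0//.
    by apply: cont_comp (@Gcont x); cont.
  - by rewrite pcat0 subr0 G1.
  - by rewrite pcat1 G1.
(* [f] is continuous only within the unit interval; [g] agrees with it there and is continuous on
   the line. *)
move=> f cf f01; pose g := f \o clamp.
have cg : continuous g.
  move=> x U Ux; have c01 : `[0, 1]%classic (clamp x).
    by rewrite /= in_itv; exact: clamp_itv.
  have H : \forall y \near x, `[0, 1]%classic (clamp y) -> U (f (clamp y)).
    exact: cont_clamp (proj1 (subspace_continuousP _ _) cf _ c01 U Ux).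
  change (\forall y \near x, U (f (clamp y))).
  by apply: filterS H => y /=; apply; rewrite in_itv; exact: clamp_itv.
have g0 : g 0 = f 0 by rewrite /g /= clamp0.
have g1 : g 1 = f 0 by rewrite /g /= clamp1.
pose q := G (f 0); pose q' t := q (1 - t).
have cq' : continuous q' by apply: cont_comp (@Gcont (f 0)); cont.
have q'1 : q' 1 = q 0 by rewrite /q' subrr.
have q1 : q 1 = g 0 by rewrite /q G1.
have H := local_system_loop cg; rewrite g0 g1 -/q in H.
have cq : continuous q := @Gcont _.
suff [h [ch h0 h1 hs]] : phom g (fun=> f 0).
  exists h; split.
  - exact: continuous_subspaceT.
  - by move=> t; rewrite h0 => t01; rewrite /g /= clampE// -in_itv.
  - by move=> t _; rewrite h1.
  - by move=> s _; have [-> ->] := hs s.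
(* With [q'] the reverse of [q], the chain is g ~ cst.g ~ (q'.q).g ~ q'.(q.g) ~ q'.q ~ cst, where
   q.g ~ q comes from [local_system_loop]. *)
have H1 := phom_sym (phom_cst_cat cg); rewrite g0 in H1.
apply: phom_trans H1 _.
have H2 := phom_rev_cat cq; rewrite q1 g0 in H2.
apply: phom_trans (phom_cat (phom_sym H2) (phom_refl cg) _) _ => //.
apply: phom_trans (phom_catA cq' cq cg q'1 q1) _.
apply: phom_trans H2.
by apply: phom_cat H _; [exact: phom_refl|rewrite pcat0].
Qed.

End LocalSystem.
End PathHomotopy.

(** * Realization of a finite simplicial complex: segments, stars and edge paths *)

Section FiniteComplex.
Local Open Scope ring_scope.

Lemma near_finite (S : Type) (F : set_system S) (FF : Filter F)
    (I : choiceType) (D : set I) (Q : I -> S -> Prop) : finite_set D ->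
  (forall i, D i -> \forall x \near F, Q i x) ->
  \forall x \near F, forall i, D i -> Q i x.
Proof.
move=> fD DQ; apply: filterS (@filter_bigI S I (fset_set D) Q F FF _).
  by move=> x Qx i Di; apply: Qx; rewrite /= in_fset_set//; exact: mem_set.
by move=> i; rewrite in_fset_set// => /set_mem; exact: DQ.
Qed.

Lemma finite_subsets (T : choiceType) (D : set T) :
  finite_set D -> finite_set [set s | s `<=` D].
Proof.
move=> fD; pose S := fpowerset (fset_set D).
apply: sub_finite_set
  (finite_image (fun A : {fset T} => [set` A]) (finite_fset S)).
move=> s sD; have fs := sub_finite_set sD fD; exists (fset_set s) => /=.
  rewrite /S fpowersetE; apply/fsubsetP => x.
  by rewrite !in_fset_set// => /set_mem/sD/mem_set.
by rewrite fset_setK.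
Qed.

Variables (R : realType) (V : choiceType) (K : set (set V)) (P : set V).
Hypothesis Pfin : finite_set P.
Hypothesis KP : forall s, K s -> s `<=` P.
Hypothesis Kn0 : forall s, K s -> s !=set0.
Hypothesis Ksub : forall s t, K s -> t `<=` s -> t !=set0 -> K t.
Hypothesis K1 : forall v, P v -> K [set v].
Local Notation X := (realization R V K).
Implicit Types (x y : X) (v w : V) (s : set V).

Local Notation supp x := [set v | bary x v != 0].

Lemma realization_eq x y : (forall v, x v = y v) -> x = y.
Proof.
case: x => f f0 fK f1; case: y => g g0 gK g1 /= fg.
have E : f = g by apply/funext.
by case: _ / E in g0 gK g1 *; congr Realization; exact: Prop_irrelevance.
Qed.

Lemma bary_continuous v : continuous (fun x : X => x v).
Proof.
apply/continuousP => A oA.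
suff : weak_open ((fun x : X => x v) @^-1` A) by [].
move=> s Ks x sx /= Ax.
have /nbhs_ballP[e /= e0 eA] : nbhs (x v) A by exact: open_nbhs_nbhs.
exists e => // y sy xy; apply: eA; rewrite /ball /=.
have [sv|sv] := pselect (s v); first exact: xy.
have z0 z : closed_simplex s z -> z v = 0.
  by move=> sz; apply/eqP; apply: contrapT => /negP /sz.
by rewrite !z0// subrr normr0.
Qed.

(** Finiteness makes the weak topology that of the coordinates. Near [a] the nonzero coordinates of
    [h a] stay nonzero, so the support of [h b] is one of the finitely many simplices containing
    that of [h a]; the neighbourhoods belonging to these simplices can be intersected. *)
Lemma realization_continuous (S : topologicalType) (h : S -> X) :
  (forall v, continuous (fun a => h a v)) -> continuous h.
Proof.
move=> ch a U; rewrite nbhsE => - [B [oB Ba] BU].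
pose D := [set s | K s /\ supp (h a) `<=` s].
have fD : finite_set D.
  by apply: sub_finite_set (finite_subsets Pfin) => s [/KP].
have near_supp : \forall b \near a, forall v, supp (h a) v -> h b v != 0.
  apply: near_finite => [|v /= av].
    exact: sub_finite_set (KP (bary_simplex (h a))) Pfin.
  have /cvgr_neq0 := ch v a; apply; exact: av.
have near_B : \forall b \near a, forall s, D s ->
    closed_simplex s (h b) -> B (h b).
  apply: near_finite => // s [Ks sa].
  have [e e0 eB] := oB s Ks (h a) sa Ba.
  have : \forall b \near a, forall v, s v -> `|h a v - h b v| < e.
    apply: near_finite => [|v sv]; first exact: sub_finite_set (KP Ks) Pfin.
    by have /cvgrPdist_lt/(_ e e0) := ch v a.
  by apply: filterS => b sb bs; apply: eB.
change (\forall b \near a, U (h b)).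
apply: filterS (filterI near_supp near_B) => b [bsupp bB].
apply: BU; apply: (bB (supp (h b))) => //; split=> //.
exact: bary_simplex.
Qed.

Definition barycentric (f : V -> R) := [/\ forall v, 0 <= f v,
  K [set v | f v != 0] & \sum_(v \in [set: V]) f v = 1].

Lemma sum_P (f : V -> R) : [set v | f v != 0] `<=` P ->
  \sum_(v \in [set: V]) f v = \sum_(v \in P) f v.
Proof.
move=> fP; apply/esym/fsbig_widen => // v [_ Pv] /=.
by apply/eqP; apply: contrapT => /negP /fP.
Qed.

Definition joinable x y := exists2 s, K s & supp x `<=` s /\ supp y `<=` s.

Lemma joinable_refl x : joinable x x.
Proof. by exists (supp x); [exact: bary_simplex|split]. Qed.

Lemma barycentric_lin x y (t : R) : joinable x y -> 0 <= t <= 1 ->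
  barycentric (fun v => (1 - t) * x v + t * y v).
Proof.
move=> [s Ks [xs ys]] /andP[t0 t1].
have sub : [set v | (1 - t) * x v + t * y v != 0] `<=` s.
  move=> v /= nz; apply: contrapT => sv; move: nz.
  have -> : x v = 0 by apply/eqP; apply: contrapT => /negP /xs.
  have -> : y v = 0 by apply/eqP; apply: contrapT => /negP /ys.
  by rewrite !mulr0 addr0 eqxx.
have sum1 : \sum_(v \in [set: V]) ((1 - t) * x v + t * y v) = 1.
  rewrite sum_P ?fsbig_split//=; last exact: subset_trans (KP Ks).
  rewrite -!mulr_fsumr -!sum_P ?bary_sum1; first by lra.
    by apply: KP; exact: bary_simplex.
  by apply: KP; exact: bary_simplex.
split=> //.
  by move=> v; rewrite addr_ge0// mulr_ge0 ?subr_ge0// bary_ge0.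
apply: Ksub Ks sub _; apply: contrapT => /set0P/negP; rewrite negbK => /eqP n0.
move: sum1; rewrite fsbig1; first by move/eqP; rewrite eq_sym oner_eq0.
move=> v _; apply/eqP; apply: contrapT => /negP nz.
by have : set0 v by rewrite -n0.
Qed.

Variable v0 : V.
Hypothesis Pv0 : P v0.

Lemma barycentric_vertex v : P v -> barycentric (fun w => (w == v)%:R).
Proof.
move=> Pv; have E : [set w | (w == v)%:R != 0 :> R] = [set v].
  apply/seteqP; split=> w /=; first by case: (w =P v) => //; rewrite eqxx.
  by move=> ->; rewrite eqxx oner_eq0.
split; first by move=> w; rewrite ler0n.
  by rewrite E; exact: K1.
rewrite -(@fsbig_widen _ _ _ _ [set v])//.
  by rewrite fsbig_set1 eqxx.
by move=> w [_ /= wv]; case: (w =P v).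
Qed.

Definition point_of (f : V -> R) (bf : barycentric f) : X :=
  let: And3 f0 fK f1 := bf in Realization f0 fK f1.

(* Total on all coordinate functions, with junk value the vertex [v0]. *)
Definition mkpoint (f : V -> R) : X :=
  if pselect (barycentric f) is left bf then point_of bf
  else point_of (barycentric_vertex Pv0).

Lemma mkpointE f v : barycentric f -> mkpoint f v = f v.
Proof. by rewrite /mkpoint; case: pselect => // -[]. Qed.

Definition vtx v : X := mkpoint (fun w => (w == v)%:R).

Lemma vtxE v w : P v -> vtx v w = (w == v)%:R.
Proof. by move=> Pv; rewrite mkpointE//; exact: barycentric_vertex. Qed.

Lemma supp_vtx v : P v -> supp (vtx v) `<=` [set v].
Proof. by move=> Pv w /=; rewrite vtxE//; case: (w =P v) => // _; rewrite eqxx. Qed.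

Definition seg x y (t : R) : X :=
  mkpoint (fun v => (1 - clamp t) * x v + clamp t * y v).

Lemma segE x y t v : joinable x y ->
  seg x y t v = (1 - clamp t) * x v + clamp t * y v.
Proof.
by move=> xy; rewrite mkpointE//; apply: barycentric_lin => //; exact: clamp_itv.
Qed.

Lemma seg0 x y : joinable x y -> seg x y 0 = x.
Proof. by move=> xy; apply: realization_eq => v; rewrite segE// clamp0; lra. Qed.

Lemma seg1 x y : joinable x y -> seg x y 1 = y.
Proof. by move=> xy; apply: realization_eq => v; rewrite segE// clamp1; lra. Qed.

Lemma segxx x t : seg x x t = x.
Proof.
by apply: realization_eq => v; rewrite segE; [lra|exact: joinable_refl].
Qed.

Lemma seg_continuous2 (S : topologicalType) (c : S -> R) (f g : S -> X) :
  continuous c -> continuous f -> continuous g ->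
  (forall a, joinable (f a) (g a)) -> continuous (fun a => seg (f a) (g a) (c a)).
Proof.
move=> cc cf cg fg; apply: realization_continuous => v.
under eq_fun do rewrite segE//.
have cfv := cont_comp cf (@bary_continuous v).
have cgv := cont_comp cg (@bary_continuous v).
have cct := cont_comp cc (@cont_clamp R).
apply: cont_add; apply: cont_mul => //; apply: cont_add; first exact: cont_cst.
exact: cont_opp.
Qed.

Lemma seg_continuous x y : joinable x y -> continuous (seg x y).
Proof.
move=> xy; apply: (@seg_continuous2 R id (fun=> x) (fun=> y)) => //.
- exact: cont_id.
- exact: cont_cst.
- exact: cont_cst.
Qed.

Lemma supp_seg s x y t : K s -> supp x `<=` s -> supp y `<=` s ->
  supp (seg x y t) `<=` s.
Proof.
move=> Ks xs ys v /=; rewrite segE; last by exists s.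
move=> nz; apply: contrapT => sv; move: nz.
have -> : x v = 0 by apply/eqP; apply: contrapT => /negP /xs.
have -> : y v = 0 by apply/eqP; apply: contrapT => /negP /ys.
by rewrite !mulr0 addr0 eqxx.
Qed.

(** At each time the two points share a closed simplex and can be joined by a segment there; these
    segments vary continuously. *)
Lemma phom_linear (f g : R -> X) : continuous f -> continuous g ->
  f 0 = g 0 -> f 1 = g 1 -> (forall t, joinable (f t) (g t)) -> phom f g.
Proof.
move=> cf cg fg0 fg1 fg; exists (fun z => seg (f z.2) (g z.2) z.1); split=> /=.
- apply: seg_continuous2 => //; first exact: cont_fst.
    by apply: cont_comp cf; exact: cont_snd.
  by apply: cont_comp cg; exact: cont_snd.
- by move=> t; rewrite seg0.
- by move=> t; rewrite seg1.
- by move=> s; rewrite -fg0 -fg1 !segxx.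
Qed.

Lemma phom_triangle s x y (z : X) : K s ->
  supp x `<=` s -> supp y `<=` s -> supp z `<=` s ->
  phom (pcat (seg x y) (seg y z)) (seg x z).
Proof.
move=> Ks xs ys zs.
have xy : joinable x y by exists s.
have yz : joinable y z by exists s.
have xz : joinable x z by exists s.
apply: phom_linear.
- by apply: pcat_cont; rewrite ?seg0 ?seg1//; exact: seg_continuous.
- exact: seg_continuous.
- by rewrite pcat0 !seg0.
- by rewrite pcat1 !seg1.
- move=> t; exists s => //; split; last exact: supp_seg.
  by rewrite /pcat; case: ifP => _; exact: supp_seg.
Qed.

Lemma joinable_star v x : P v -> x v != 0 -> joinable (vtx v) x.
Proof.
move=> Pv xv; exists (supp x); first exact: bary_simplex.
by split=> // w /(supp_vtx Pv) ->.
Qed.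

(* The cone of [p] over [v] is a map on a square, in which the two paths are
   homotopic. *)
Lemma phom_star v (p : R -> X) : P v -> continuous p ->
  (forall t, p t v != 0) ->
  phom (pcat (seg (vtx v) (p 0)) p) (seg (vtx v) (p 1)).
Proof.
move=> Pv cp pv; have jp t : joinable (vtx v) (p t) by exact: joinable_star.
pose F (z : R * R) := seg (vtx v) (p z.1) z.2.
have cF : continuous F.
  apply: seg_continuous2 => //; first exact: cont_snd.
    exact: cont_cst.
  by apply: cont_comp cp; exact: cont_fst.
(* The point ([a], [b]) climbs from (0,0) to (0,1), then crosses to (1,1). It is deformed linearly
   to the side from (1,0) to (1,1); the starting point slides along the side on which [F] is
   constantly the apex. *)
pose a (t : R) : R := Num.max 0 (2 * t - 1).
pose b (t : R) : R := Num.min (2 * t) 1.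
have ca : continuous a by rewrite /a; cont.
have cb : continuous b by rewrite /b; cont.
exists (fun z => F ((1 - z.1) * a z.2 + z.1, (1 - z.1) * b z.2 + z.1 * z.2)).
split=> /=.
- apply: cont_comp cF; apply: cont_pair.
    by cont; apply: cont_comp ca; cont.
  by cont; apply: cont_comp cb; cont.
- move=> t; rewrite /pcat /F /a /b /= subr0 !mul1r addr0 mul0r addr0.
  case: ifP => t1.
    by rewrite max_l ?min_l; [congr seg; lra|lra|lra].
  rewrite max_r; last by lra.
  rewrite min_r; last by lra.
  by rewrite seg1//; congr p; lra.
- by move=> t; rewrite /F /= subrr !mul0r !add0r mul1r.
- have b0 : b 0 = 0 by rewrite /b min_l; lra.
  have b1 : b 1 = 1 by rewrite /b min_r; lra.
  have a1 : a 1 = 1 by rewrite /a max_r; lra.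
  move=> s; rewrite pcat0 pcat1 seg0// /F /= b0 a1 b1 !mulr0 addr0 seg0//.
  by rewrite !mulr1 subrK seg1.
Qed.

Definition adj v w := [/\ P v, P w & K [set v; w]].

(* Edge paths start at [v0] and are listed backwards: the head is the end. *)
Fixpoint edge_path (l : seq V) : R -> X :=
  if l is w :: l' then pcat (edge_path l') (seg (vtx (head v0 l')) (vtx w))
  else fun=> vtx v0.

Fixpoint is_edge_path (l : seq V) : Prop :=
  if l is w :: l' then adj (head v0 l') w /\ is_edge_path l' else True.

Lemma joinable_adj v w : adj v w -> joinable (vtx v) (vtx w).
Proof.
move=> [Pv Pw Kvw]; exists [set v; w] => //.
by split=> u /(supp_vtx _) ->//; [left|right].
Qed.

Lemma edge_path1 l : is_edge_path l -> edge_path l 1 = vtx (head v0 l).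
Proof.
by case: l => //= w l [vw _]; rewrite pcat1 seg1//; exact: joinable_adj.
Qed.

Lemma edge_path0 l : is_edge_path l -> edge_path l 0 = vtx v0.
Proof. by elim: l => //= w l IH [_ /IH]; rewrite pcat0. Qed.

Lemma edge_path_continuous l : is_edge_path l -> continuous (edge_path l).
Proof.
elim: l => [_|w l IH /= [/joinable_adj vw ok]]; first exact: cont_cst.
apply: pcat_cont; [exact: IH|exact: seg_continuous|].
by rewrite edge_path1// seg0.
Qed.

Definition edge_equiv l l' := [/\ is_edge_path l, is_edge_path l',
  head v0 l = head v0 l' & phom (edge_path l) (edge_path l')].

Lemma edge_equiv_sym l l' : edge_equiv l l' -> edge_equiv l' l.
Proof. by move=> [ok ok' hd /phom_sym]. Qed.

Lemma edge_equiv_trans l' l l'' :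
  edge_equiv l l' -> edge_equiv l' l'' -> edge_equiv l l''.
Proof.
move=> [ok ok' hd h] [_ ok'' hd' h']; split=> //; first by rewrite hd.
exact: phom_trans h h'.
Qed.

(** As lists are read backwards, [t ++ l] follows [l] first and then [t]: a common continuation
    preserves homotopy. *)
Lemma edge_equiv_cat t l l' :
  edge_equiv l l' -> is_edge_path (t ++ l) -> edge_equiv (t ++ l) (t ++ l').
Proof.
move=> e; elim: t => //= w t IH [vw /IH [ok ok' hd h]].
split=> //=; first by rewrite -hd.
rewrite -hd; have jvw := joinable_adj vw; apply: phom_cat => //.
  by apply: phom_refl; exact: seg_continuous.
by rewrite seg0// edge_path1.
Qed.

Lemma edge_equiv_triangle v w l : is_edge_path l ->
  K [set head v0 l; v; w] -> edge_equiv (w :: v :: l) (w :: l).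
Proof.
set u := head v0 l => ok Kuvw.
have sub a b : [set u; v; w] a -> [set u; v; w] b -> adj a b.
  move=> sa sb; split; [exact: KP sa|exact: KP sb|].
  by apply: Ksub Kuvw _ _; [move=> c [] ->|exists a; left].
have su : [set u; v; w] u by left; left.
have sv : [set u; v; w] v by left; right.
have sw : [set u; v; w] w by right.
have uv := sub u v su sv; have vw := sub v w sv sw; have uw := sub u w su sw.
split=> //=; rewrite -/u; have jo := joinable_adj.
have [Pu Pv _] := uv; have [_ Pw _] := vw.
have juv := jo _ _ uv; have jvw := jo _ _ vw.
apply: phom_trans (phom_catA _ _ _ _ _) _; rewrite ?seg0 ?seg1 ?edge_path1//.
- exact: edge_path_continuous.
- exact: seg_continuous.
- exact: seg_continuous.
apply: phom_cat.
- by apply: phom_refl; exact: edge_path_continuous.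
- by apply: (phom_triangle Kuvw) => a /(supp_vtx _) ->.
- by rewrite pcat0 seg0// edge_path1.
Qed.

(** * Simple connectivity from edge paths compatible with edges *)

Section SpanningPaths.
Variable g : V -> seq V.
Hypothesis g_path : forall v, P v -> is_edge_path (g v).
Hypothesis g_head : forall v, P v -> head v0 (g v) = v.
Hypothesis g_edge : forall v w, adj v w ->
  edge_equiv (w :: g v) (g w).

(** The path to a point x follows [g] to some vertex of the simplex carrying x, then a segment. By
    [g_edge] and a triangle, its class does not depend on the vertex. Hence on the open star of v
    one may use v throughout, and compatibility there is [phom_star]. *)
Lemma edge_paths_simply_connected : simply_connected R X.
Proof.
(* The vertex [c x] is an arbitrary choice and jumps as x varies; [indep] repairs this. *)
have supp_ex x : {v | x v != 0} by exact: cid (Kn0 (bary_simplex x)).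
pose c x := sval (supp_ex x).
have cP x : x (c x) != 0 := svalP (supp_ex x).
have suppP x v : x v != 0 -> P v.
  by move=> xv; apply: (KP (bary_simplex x)).
pose G x := pcat (edge_path (g (c x))) (seg (vtx (c x)) x).
have Pc x : P (c x) := suppP _ _ (cP x).
have join v x : x v != 0 -> joinable (vtx v) x.
  by move=> xv; apply: joinable_star => //; exact: suppP xv.
have e1 v : P v -> edge_path (g v) 1 = vtx v.
  by move=> Pv; rewrite edge_path1 ?g_head//; exact: g_path.
have ec v : P v -> continuous (edge_path (g v)).
  by move=> Pv; apply: edge_path_continuous; exact: g_path.
have indep v x : x v != 0 ->
    phom (G x) (pcat (edge_path (g v)) (seg (vtx v) x)).
  move=> xv; have Pv := suppP _ _ xv.
  have Kx := bary_simplex x; have Pcx := Pc x.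
  have cv : adj (c x) v.
    split=> //; apply: (Ksub Kx); last by exists v; right.
    by move=> w [] ->; [exact: cP|exact: xv].
  have [_ _ _ /= Hcv] := g_edge cv; rewrite g_head// in Hcv.
  have jcv := joinable_adj cv.
  have jvx := join _ _ xv; have jcx := join _ _ (cP x).
  apply: phom_trans (phom_cat Hcv (phom_refl (seg_continuous jvx)) _).
    apply: phom_sym; apply: phom_trans (phom_catA _ _ _ _ _) _;
      rewrite ?seg0 ?seg1 ?e1//.
    - exact: ec.
    - exact: seg_continuous.
    - exact: seg_continuous.
    apply: phom_cat; first by apply: phom_refl; exact: ec.
      apply: (phom_triangle Kx) => //.
        by move=> w /(supp_vtx Pcx) ->; exact: cP.
      by move=> w /(supp_vtx Pv) ->.
    by rewrite pcat0 seg0// e1.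
  by rewrite pcat1 seg1// seg0.
apply: (@local_system_simply_connected R X (vtx v0) G).
- move=> x; apply: pcat_cont; [exact: ec|exact/seg_continuous/join|].
  by rewrite e1// seg0//; exact: join.
- by move=> x; rewrite /G pcat0 edge_path0//; exact: g_path.
- by move=> x; rewrite /G pcat1 seg1//; exact: join.
- move=> x; set v := c x; have Pv : P v := Pc x.
  exists [set y : X | y v != 0].
    have /cvgr_neq0 := @bary_continuous v x; apply; exact: cP.
  move=> p cp pv.
  have j0 := join _ _ (pv 0); have j1 := join _ _ (pv 1).
  apply: phom_trans (phom_cat (indep _ _ (pv 0)) (phom_refl cp) _) _.
    by rewrite /G pcat1 seg1//; exact: join.
  apply: phom_trans (phom_sym (indep _ _ (pv 1))).
  apply: phom_trans (phom_catA _ _ _ _ _) _; rewrite ?seg0 ?seg1 ?e1//.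
  + exact: ec.
  + exact: seg_continuous.
  apply: phom_cat; [by apply: phom_refl; exact: ec|exact: phom_star|].
  by rewrite pcat0 seg0// e1.
Qed.

End SpanningPaths.
End FiniteComplex.

(** * The order complex of the coset poset *)

Section CosetPoset.
Variables (R : realType) (G : groupType) (F : set (set G)).
Hypothesis Gfin : finite_set [set: G].
Hypothesis F_subgroup : forall H, F H -> is_subgroup H.
Hypothesis F1 : F [set 1%g].
Hypothesis FI : forall H H', F H -> F H' -> F (H `&` H').

Local Notation P := (coset_poset F).
Local Notation K := (order_complex (@subset G) P).
Implicit Types (C D : set G) (g r : G) (l : seq (set G)).

Lemma coset_posetP D g : P D -> D g -> exists2 H, F H & D = left_coset g H.
Proof.
move=> [a _ [H FH <-]] [h Hh <-]; exists H => //.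
have [H1 HM HV] := F_subgroup FH; apply/seteqP; split=> x [k Hk <-].
  by exists (h^-1 * k)%g; [apply: HM => //; exact: HV|rewrite mulgA mulgK].
by exists (h * k)%g; [exact: HM|rewrite mulgA].
Qed.

Lemma left_cosetP g H : F H -> P (left_coset g H).
Proof. by move=> FH; exists g => //; exists H. Qed.

Lemma mem_left_coset g h H : H h -> left_coset g H (g * h)%g.
Proof. by move=> Hh; exists h. Qed.

Lemma mem_left_coset1 g H : F H -> left_coset g H g.
Proof. by move=> /F_subgroup[H1 _ _]; exists 1%g => //; rewrite mulg1. Qed.

Lemma coset_poset1 g : P [set g].
Proof.
exists g => //; exists [set 1%g] => //; apply/seteqP; split=> x /=.
  by move=> [_ -> <-]; rewrite mulg1.
by move=> ->; exists 1%g => //; rewrite mulg1.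
Qed.

Lemma coset_posetI C D g : P C -> P D -> C g -> D g -> P (C `&` D).
Proof.
move=> PC PD Cg Dg.
have [H FH ->] := coset_posetP PC Cg; have [H' FH' ->] := coset_posetP PD Dg.
exists g => //; exists (H `&` H'); first exact: FI.
apply/seteqP; split=> x; first by move=> [h [Hh H'h] <-]; split; exists h.
move=> [[h Hh <-] [h' H'h' /mulgI eh]]; exists h => //; split=> //.
by rewrite -eh.
Qed.

Lemma coset_poset_n0 D : P D -> exists g, D g.
Proof. by move=> [g _ [H FH <-]]; exists g; exact: mem_left_coset1. Qed.

Lemma coset_poset_finite : finite_set P.
Proof. exact: sub_finite_set (finite_subsets Gfin). Qed.

Lemma order_complexP s : K s -> s `<=` P.
Proof. by case. Qed.

Lemma order_complex_n0 s : K s -> s !=set0.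
Proof. by case. Qed.

Lemma order_complex_sub s t : K s -> t `<=` s -> t !=set0 -> K t.
Proof.
move=> [fs _ sP sc] ts t0; split=> //.
- exact: sub_finite_set fs.
- exact: subset_trans sP.
- by move=> x y tx ty; apply: sc; exact: ts.
Qed.

Definition comparable C D := C `<=` D \/ D `<=` C.

Lemma order_complex3 B C D : P B -> P C -> P D ->
  comparable B C -> comparable C D -> comparable B D -> K [set B; C; D].
Proof.
move=> PB PC PD BC CD BD; split.
- by rewrite !finite_setU; do !split; exact: finite_set1.
- by exists B; left; left.
- by move=> _ [[]|] ->.
- have cc E : comparable E E by left.
  have cs E E' : comparable E E' -> comparable E' E.
    by case=> ?; [right|left].
  by move=> _ _ [[]|] -> [[]|] ->; try exact: cc; try done; exact: cs.
Qed.

Lemma order_complex2 C D : P C -> P D -> comparable C D -> K [set C; D].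
Proof.
move=> PC PD CD; apply: (@order_complex_sub [set C; C; D]).
- by apply: order_complex3 => //; left.
- by move=> _ [] ->; [left; left|right].
- by exists C; left.
Qed.

Lemma order_complex1 D : P D -> K [set D].
Proof.
move=> PD; apply: (@order_complex_sub [set D; D]).
- by apply: order_complex2 => //; left.
- by move=> _ ->; left.
- by exists D.
Qed.

Local Notation v0 := [set (1 : G)%g].

Local Notation edgep l := (is_edge_path K P v0 l).
Local Notation "l ~~> l'" := (@edge_equiv R _ K P order_complex1 v0
  (coset_poset1 1%g) l l') (at level 70).

Let sym l l' : l ~~> l' -> l' ~~> l.
Proof. exact: edge_equiv_sym. Qed.

Let trans l' l l'' : l ~~> l' -> l' ~~> l'' -> l ~~> l''.
Proof. exact: edge_equiv_trans. Qed.

Let cat t l l' : l ~~> l' -> edgep (t ++ l) -> (t ++ l) ~~> (t ++ l').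
Proof.
exact: (edge_equiv_cat coset_poset_finite order_complexP order_complex_sub).
Qed.

Let triangle C D l : edgep l -> K [set head v0 l; C; D] ->
  (D :: C :: l) ~~> (D :: l).
Proof.
exact: (edge_equiv_triangle R coset_poset_finite order_complexP
  order_complex_sub).
Qed.

(* Prolongs an edge path ending at {r}, with r in D, by {r} - D - {r'}. *)
Definition jump D r' l := [set r'] :: D :: l.

Lemma adj_comparable C D : P C -> P D -> comparable C D -> adj K P C D.
Proof. by move=> PC PD CD; split=> //; exact: order_complex2. Qed.

Lemma sub_set1 D r : D r -> [set r] `<=` D.
Proof. by move=> Dr _ ->. Qed.

(** * Calculus of jumps between group elements inside cosets *)

Section Jumps.
Variables (l : seq (set G)) (r : G).
Hypothesis (lp : edgep l) (lr : head v0 l = [set r]).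

Lemma cons_path D : P D -> D r -> edgep (D :: l).
Proof.
move=> PD Dr; split=> //; rewrite lr; apply: adj_comparable => //.
  exact: coset_poset1.
by left; exact: sub_set1.
Qed.

Lemma jump_path D r' : P D -> D r -> D r' -> edgep (jump D r' l).
Proof.
move=> PD Dr Dr'; split; last exact: cons_path.
apply: adj_comparable => //; first exact: coset_poset1.
by right; exact: sub_set1.
Qed.

Lemma cons_sub C D : P C -> P D -> C `<=` D -> C r ->
  (D :: C :: l) ~~> (D :: l).
Proof.
move=> PC PD CD Cr; apply: triangle => //; rewrite lr.
apply: order_complex3 => //; first exact: coset_poset1.
- by left; exact: sub_set1.
- by left.
- by left; apply: sub_set1; exact: CD.
Qed.

(** Both paths are compared with {r} - C - D - {r'}, through the triangles {r}, C, D and C, D,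
    {r'}. *)
Lemma jump_sub C D r' : P C -> P D -> C `<=` D -> C r -> C r' ->
  jump C r' l ~~> jump D r' l.
Proof.
move=> PC PD CD Cr Cr'.
have Clp := cons_path PC Cr.
have DC : (D :: C :: l) ~~> (D :: l) by exact: cons_sub.
have rDC : ([set r'] :: D :: C :: l) ~~> ([set r'] :: C :: l).
  apply: triangle => //=; apply: order_complex3 => //; first exact: coset_poset1.
  - by left.
  - by right; apply: sub_set1; exact: CD.
  - by right; exact: sub_set1.
apply: trans (sym rDC) _; apply: (@cat [:: [set r']] _ _ DC).
by case: rDC.
Qed.

(** Both jumps can be pushed down to the intersection, which is again a coset of a member of the
    family. *)
Lemma jump_indep C D r' : P C -> P D -> C r -> C r' -> D r -> D r' ->
  jump C r' l ~~> jump D r' l.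
Proof.
move=> PC PD Cr Cr' Dr Dr'.
have PI := coset_posetI PC PD Cr Dr.
apply: (@trans (jump (C `&` D) r' l)); first apply: sym.
  by apply: jump_sub => //; exact: subIsetl.
by apply: jump_sub => //; exact: subIsetr.
Qed.

Lemma cons_jump D r' : P D -> D r -> D r' -> (D :: jump D r' l) ~~> (D :: l).
Proof.
move=> PD Dr Dr'; have Dlp := cons_path PD Dr.
have s1 : (D :: jump D r' l) ~~> (D :: D :: l).
  apply: triangle => //=; apply: order_complex3 => //; first exact: coset_poset1.
  - by right; exact: sub_set1.
  - by left; exact: sub_set1.
  - by left.
by apply: trans s1 _; exact: cons_sub.
Qed.

Lemma jump_comp D r' r'' : P D -> D r -> D r' -> D r'' ->
  jump D r'' (jump D r' l) ~~> jump D r'' l.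
Proof.
move=> PD Dr Dr' Dr''; have H := cons_jump PD Dr Dr'.
apply: (@cat [:: [set r'']] _ _ H); split; last by case: H.
apply: adj_comparable => //; first exact: coset_poset1.
by right; exact: sub_set1.
Qed.

Lemma jump_cong D r' l' : P D -> D r -> D r' ->
  l ~~> l' -> jump D r' l ~~> jump D r' l'.
Proof.
move=> PD Dr Dr' ll'; apply: (@cat [:: [set r']; D] _ _ ll').
exact: jump_path.
Qed.

End Jumps.

(** * Groups with a factorization into complements A and E *)

Section Complements.
Variables (A E : set G) (pa pe : G -> G).
Hypotheses (FA : F A) (FE : F E).
Hypothesis paA : forall g, A (pa g).
Hypothesis peE : forall g, E (pe g).
Hypothesis pae : forall g, (pa g * pe g)%g = g.
Hypothesis pa_uniq : forall a e, A a -> E e -> pa (a * e)%g = a.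
Hypothesis EnormA : forall a e, A a -> E e -> A (e * a * e^-1)%g.
Hypothesis AE_sub : forall e, E e -> exists H, [/\ F H, A `<=` H & H e].

Let A1 : A 1%g. Proof. by have [] := F_subgroup FA. Qed.
Let AM x y : A x -> A y -> A (x * y)%g.
Proof. by have [_ + _] := F_subgroup FA; apply. Qed.
Let EM x y : E x -> E y -> E (x * y)%g.
Proof. by have [_ + _] := F_subgroup FE; apply. Qed.

Let PA : P A.
Proof.
have -> : A = left_coset 1%g A; last exact: left_cosetP.
apply/seteqP; split=> x; first by move=> Ax; exists x => //; rewrite mul1g.
by move=> [y Ay <-]; rewrite mul1g.
Qed.

Definition to_A a := jump A a [::].
Definition route g := jump (left_coset (pa g) E) g (to_A (pa g)).

Let to_A_path a : A a -> edgep (to_A a).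
Proof. by move=> Aa; exact: (@jump_path [::] 1%g). Qed.

Let mem_AE a e : E e -> left_coset a E (a * e)%g.
Proof. exact: mem_left_coset. Qed.

Let mem_pae g : left_coset (pa g) E g.
Proof. by rewrite -{2}(pae g); exact: mem_AE. Qed.

Lemma route_path g : edgep (route g).
Proof.
apply: (@jump_path _ (pa g)) => //; first exact: to_A_path.
- exact: left_cosetP.
- exact: mem_left_coset1.
Qed.

(** Right multiplication by [f] keeps the A-part, so the jump can be made in the coset aE that ends
    the route to r, and merges with its last leg. *)
Lemma route_E r f D : E f -> P D -> D r -> D (r * f)%g ->
  jump D (r * f)%g (route r) ~~> route (r * f)%g.
Proof.
move=> Ef PD Dr Drf.
have rfE : (r * f = pa r * (pe r * f))%g by rewrite mulgA pae.
have parf : pa (r * f)%g = pa r by rewrite rfE pa_uniq//; exact: EM.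
have PC : P (left_coset (pa r) E) by exact: left_cosetP.
have Crf : left_coset (pa r) E (r * f)%g by rewrite rfE; apply: mem_AE; exact: EM.
apply: trans (jump_indep (route_path r) _ PD PC Dr Drf _ Crf) _ => //.
rewrite /route parf; apply: (@jump_comp _ (pa r)) => //; first exact: to_A_path.
exact: mem_left_coset1.
Qed.

(** With r = ae and b' = e b e^-1 one has rb = (ab')e. The elements a, ab', r and rb all lie in aH,
    where H contains A and e, so the change of route takes place inside this one coset. *)
Lemma route_A r b D : A b -> P D -> D r -> D (r * b)%g ->
  jump D (r * b)%g (route r) ~~> route (r * b)%g.
Proof.
move=> Ab PD Dr Drb; set a := pa r; set e := pe r.
have [Aa Ee ae] : [/\ A a, E e & (a * e)%g = r].
  by split; [exact: paA|exact: peE|exact: pae].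
have [H [FH AH He]] := AE_sub Ee.
have [H1 HM HV] := F_subgroup FH.
pose b' := (e * b * e^-1)%g; have Ab' : A b' by exact: EnormA.
have rbE : (r * b = a * b' * e)%g by rewrite /b' -ae !mulgA mulgVK.
pose C := left_coset a H; have PC : P C by exact: left_cosetP.
have Ca : C a by exact: mem_left_coset1.
have Cr : C r by rewrite -ae; exact: mem_left_coset.
have Cab' : C (a * b')%g by apply: mem_left_coset; exact: AH.
have Crb : C (r * b)%g.
  by rewrite rbE -mulgA; apply: mem_left_coset; apply: HM => //; exact: AH.
have parb : pa (r * b)%g = (a * b')%g by rewrite rbE pa_uniq//; exact: AM.
have PE c : P (left_coset c E) by exact: left_cosetP.
have lE c : left_coset c E c by exact: mem_left_coset1.
have toa := to_A_path Aa.
have Aab' := AM Aa Ab'.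
(* The legs through [D] and aE are moved into [C] and merged into one jump from a to rb, which is
   then split at ab'. *)
apply: trans (jump_indep (route_path r) _ PD PC Dr Drb Cr Crb) _ => //.
apply: trans (jump_cong (route_path r) _ PC Cr Crb
  (jump_indep toa _ (PE a) PC _ _ Ca Cr)) _ => //; first exact: mem_pae.
apply: trans (jump_comp toa _ PC Ca Cr Crb) _ => //.
apply: trans (sym (jump_comp toa _ PC Ca Cab' Crb)) _ => //.
have Eabrb : left_coset (a * b')%g E (r * b)%g by rewrite rbE; exact: mem_AE.
(* The first half, from a to ab', may pass through [A] instead and merges with [to_A a]; the second
   half is then moved to the coset of E at ab'. *)
have CA : jump C (a * b')%g (to_A a) ~~> to_A (a * b')%g.
  apply: trans (jump_indep toa _ PC PA Ca Cab' Aa Aab') _ => //.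
  exact: (@jump_comp [::] 1%g).
apply: trans (jump_indep (jump_path toa _ PC Ca Cab') _ PC (PE (a * b')%g)
  Cab' Crb (lE _) Eabrb) _ => //.
rewrite /route parb; apply: (@jump_cong _ (a * b')%g) => //.
by apply: (@jump_path _ a).
Qed.

(** Factor r^-1 r' as bf with b in A and f in E. A subgroup H of the family containing A and f puts
    r, rb and r' into the coset rH, where the jump splits at rb into the two cases above. *)
Lemma route_jump r r' D : P D -> D r -> D r' ->
  jump D r' (route r) ~~> route r'.
Proof.
move=> PD Dr Dr'; set b := pa (r^-1 * r')%g; set f := pe (r^-1 * r')%g.
have r'E : r' = (r * b * f)%g by rewrite -mulgA /b /f pae mulVKg.
have [Ab Ef] : A b /\ E f by split; [exact: paA|exact: peE].
have [H [FH AH Hf]] := AE_sub Ef; have [H1 HM HV] := F_subgroup FH.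
pose C := left_coset r H; have PC : P C by exact: left_cosetP.
have Cr : C r by exact: mem_left_coset1.
have Crb : C (r * b)%g by apply: mem_left_coset; exact: AH.
have Cr' : C r'.
  by rewrite r'E -mulgA; apply: mem_left_coset; apply: HM => //; exact: AH.
have rp := route_path r.
apply: trans (jump_indep rp _ PD PC Dr Dr' Cr Cr') _ => //.
apply: trans (sym (jump_comp rp _ PC Cr Crb Cr')) _ => //.
apply: trans (jump_cong (jump_path rp _ PC Cr Crb) _ PC Crb Cr'
  (route_A Ab PC Cr Crb)) _ => //.
by rewrite {1 2}r'E; apply: route_E => //; rewrite -r'E.
Qed.

Lemma cons_route D r r' : P D -> D r -> D r' ->
  (D :: route r) ~~> (D :: route r').
Proof.
move=> PD Dr Dr'; have rp := route_path r.
apply: trans (sym (cons_jump rp _ PD Dr Dr')) _ => //.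
have H := route_jump PD Dr Dr'.
apply: (@cat [:: D] _ _ H); apply: (@cons_path _ r') => //.
by case: H.
Qed.

Lemma coset_space_simply_connected : simply_connected R (coset_space R F).
Proof.
(* A representative of each coset; the default 1 occurs only for the empty set. The vertex [D] is
   reached by the route to [c D] and one more edge. *)
pose c D := if pselect (exists g, D g) is left H then sval (cid H) else 1%g.
have cD D : P D -> D (c D).
  by move=> /coset_poset_n0 H; rewrite /c; case: pselect => // H'; case: cid.
apply: (@edge_paths_simply_connected R _ K P coset_poset_finite order_complexP
  order_complex_n0 order_complex_sub order_complex1 v0 (coset_poset1 1%g)
  (fun D => D :: route (c D))) => //.
- by move=> D PD; apply: (@cons_path _ (c D)) => //; [exact: route_path|exact: cD].
- move=> C D [PC PD KCD].
  have : comparable C D.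
    by have [_ _ _ tot] := KCD; apply: tot; [left|right].
  have Cc := cD _ PC; have Dd := cD _ PD.
  (* If C lies in D, the vertex C is dropped first and the representative is changed inside D.
     Otherwise the representative is first changed inside C to [c D], and then C is dropped. *)
  case=> [CD|DC].
    apply: trans (cons_sub (route_path _) _ PC PD CD Cc) _ => //.
    by apply: cons_route => //; exact: CD.
  have H := cons_route PC Cc (DC _ Dd).
  have step : (D :: C :: route (c D)) ~~> (D :: route (c D)).
    apply: triangle; first exact: route_path.
    apply: order_complex3 => //; first exact: coset_poset1.
    - by left; apply: sub_set1; exact: DC.
    - by right.
    - by left; exact: sub_set1.
  apply: trans (@cat [:: D] _ _ H _) step.
  split; last by case: H.
  by apply: adj_comparable => //; right.
Qed.

End Complements.
End CosetPoset.

(** * Lower central series and nilpotency of class at most 2 *)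

Section LowerCentral.
Variable G : groupType.
Implicit Types H Z : set G.

Lemma is_subgroupI H H' :
  is_subgroup H -> is_subgroup H' -> is_subgroup (H `&` H').
Proof.
move=> [H1 HM HV] [H1' HM' HV']; split=> //.
- by move=> x y [? ?] [? ?]; split; [exact: HM|exact: HM'].
- by move=> x [? ?]; split; [exact: HV|exact: HV'].
Qed.

Lemma is_subgroup1 : is_subgroup [set (1 : G)%g].
Proof. by split=> //= [x y -> ->|x ->]; rewrite ?mulg1 ?invg1. Qed.

Lemma is_subgroup_smallest (S : set G) : is_subgroup (smallest (@is_subgroup G) S).
Proof.
split; first by move=> H [[H1 _ _] _].
- move=> x y Sx Sy H [sH SH]; have [_ HM _] := sH.
  by apply: HM; [exact: Sx|exact: Sy].
- by move=> x Sx H [sH SH]; have [_ _ HV] := sH; apply: HV; exact: Sx.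
Qed.

Lemma lower_central_subgroup H n : is_subgroup H -> is_subgroup (lower_central H n).
Proof. by case: n => [//|n] _; exact: is_subgroup_smallest. Qed.

Lemma lower_central_mono H H' n :
  H `<=` H' -> lower_central H n `<=` lower_central H' n.
Proof.
move=> HH'; elim: n => //= n IH; apply: sub_smallest2r.
  exact: is_subgroup_smallest.
by move=> _ [x Hx [y Hy <-]]; exists x; [exact: IH|exists y => //; exact: HH'].
Qed.

Lemma nilpotent_subgroupsI q H H' : is_subgroup H' ->
  nilpotent_subgroups q H -> nilpotent_subgroups q (H `&` H').
Proof.
move=> sH' [sH nH]; have sHH' := is_subgroupI sH sH'; split=> //.
apply/seteqP; split=> [x /(lower_central_mono (@subIsetl _ H H'))|_ ->].
  by rewrite nH.
by have [] := lower_central_subgroup q sHH'.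
Qed.

(** The commutators of [H] lie in [Z], which commutes with [H]; the series is therefore trivial from
    index 2 on, counting from 0. *)
Lemma nilpotent_class2 q H Z : (2 <= q)%N -> is_subgroup H -> is_subgroup Z ->
  (forall x y, H x -> H y -> Z (commg x y)) ->
  (forall z y, Z z -> H y -> commg z y = 1%g) ->
  nilpotent_subgroups q H.
Proof.
move=> q2 sH sZ HZ Z1; split=> //.
apply/seteqP; split=> [|_ ->]; last by have [] := lower_central_subgroup q sH.
have L1 : lower_central H 1 `<=` Z.
  by apply: smallest_sub => // _ [x Hx [y Hy <-]]; exact: HZ.
rewrite -(subnK q2); elim: (q - 2)%N => [|n IH].
  apply: smallest_sub => [|_ [x /L1 Zx [y Hy <-]]]; first exact: is_subgroup1.
  exact: Z1.
apply: smallest_sub => [|_ [x /IH -> [y Hy <-]]]; first exact: is_subgroup1.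
by rewrite /= comm1g.
Qed.

End LowerCentral.

(** * The wreath product and its subgroups of class at most 2 *)

Section Wreath.
Variable n : nat.

Local Notation vec := {ffun 'I_n -> bool}.
Implicit Types (u v x : vec).

Definition vadd u v : vec := [ffun i => u i (+) v i].
Definition vzero : vec := [ffun=> false].

Lemma vaddA : associative vadd.
Proof. by move=> u v x; apply/ffunP => i; rewrite !ffunE addbA. Qed.

Lemma vaddC : commutative vadd.
Proof. by move=> u v; apply/ffunP => i; rewrite !ffunE addbC. Qed.

Lemma vadd0 u : vadd u vzero = u.
Proof. by apply/ffunP => i; rewrite !ffunE addbF. Qed.

Lemma vadd0l u : vadd vzero u = u.
Proof. by rewrite vaddC vadd0. Qed.

Lemma vaddK u v : vadd (vadd u v) v = u.
Proof. by apply/ffunP => i; rewrite !ffunE addbK. Qed.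

Lemma vaddv u : vadd u u = vzero.
Proof. by apply/ffunP => i; rewrite !ffunE addbb. Qed.

(* The wreath product of Z/2 with (Z/2)^n; the second component acts on the
   functions of the first one by translation. *)
Definition wreath := ({ffun vec -> bool} * vec)%type.
Implicit Types g h : wreath.

Definition wmul g h : wreath :=
  ([ffun x => g.1 x (+) h.1 (vadd x g.2)], vadd g.2 h.2).
Definition wone : wreath := ([ffun=> false], vzero).
Definition winv g : wreath := ([ffun x => g.1 (vadd x g.2)], g.2).

Lemma wreath_eq g h : (forall x, g.1 x = h.1 x) -> g.2 = h.2 -> g = h.
Proof. by case: g h => [a e] [b f] /= ab ->; congr pair; apply/ffunP. Qed.

Lemma wmulA : associative wmul.
Proof.
move=> g h k; apply: wreath_eq => [x|] /=; last by rewrite vaddA.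
by rewrite !ffunE addbA vaddA.
Qed.

Lemma wmul1g : left_id wone wmul.
Proof. by move=> g; apply: wreath_eq => [x|] /=; rewrite ?ffunE ?vadd0// vadd0l. Qed.

Lemma wmulg1 : right_id wone wmul.
Proof. by move=> g; apply: wreath_eq => [x|] /=; rewrite ?ffunE ?addbF// vadd0. Qed.

Lemma wmulVg : left_inverse wone winv wmul.
Proof. by move=> g; apply: wreath_eq => [x|] /=; rewrite ?ffunE ?addbb// vaddv. Qed.

Lemma wmulgV : right_inverse wone winv wmul.
Proof.
by move=> g; apply: wreath_eq => [x|] /=; rewrite ?ffunE ?vaddK ?addbb// vaddv.
Qed.

HB.instance Definition _ := Finite.copy wreath ({ffun vec -> bool} * vec)%type.
HB.instance Definition _ :=
  isGroup.Build wreath wmulA wmul1g wmulg1 wmulVg wmulgV.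

Lemma wmulE1 g h x : (g * h)%g.1 x = g.1 x (+) h.1 (vadd x g.2).
Proof. by rewrite ffunE. Qed.

Lemma wmulE2 g h : (g * h)%g.2 = vadd g.2 h.2.
Proof. by []. Qed.

Lemma winvE1 g x : (g^-1)%g.1 x = g.1 (vadd x g.2).
Proof. by rewrite ffunE. Qed.

Lemma winvE2 g : (g^-1)%g.2 = g.2.
Proof. by []. Qed.

Lemma woneE1 x : (1 : wreath)%g.1 x = false.
Proof. by rewrite ffunE. Qed.

(** For g = (a, e) and h = (b, f) this is the difference of a in direction f, taken at x + e, plus
    the difference of b in direction e, taken at x + f. *)
Lemma commgE1 g h x : (commg g h).1 x = g.1 (vadd x g.2) (+)
  (h.1 (vadd (vadd x g.2) h.2) (+)
   (g.1 (vadd (vadd x g.2) h.2) (+) h.1 (vadd x h.2))).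
Proof.
rewrite /commg /conjg !(wmulE1, wmulE2, winvE1, winvE2).
do 3?congr addb; congr (h.1 _).
by rewrite -!vaddA (vaddC h.2) !vaddA vaddK.
Qed.

Lemma commgE2 g h : (commg g h).2 = vzero.
Proof.
rewrite /commg /conjg !(wmulE2, winvE2).
by rewrite (vaddC g.2 h.2) !vaddA vaddK vaddv.
Qed.

Definition wA : set wreath := [set g : wreath | g.2 = vzero].
Definition wE : set wreath := [set g : wreath | forall x, g.1 x = false].
Definition wAE v : set wreath := [set g : wreath | g.2 = vzero \/ g.2 = v].
(** The functions invariant under translation by v, which serve as a central subgroup for
    [wAE v]. *)
Definition wZ v : set wreath :=
  [set g : wreath | g.2 = vzero /\ forall x, g.1 (vadd x v) = g.1 x].

Lemma wE_subgroup : is_subgroup wE.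
Proof.
split=> /=; first exact: woneE1.
- by move=> g h gE hE x; rewrite wmulE1 gE hE.
- by move=> g gE x; rewrite winvE1.
Qed.

Lemma wAE_subgroup v : is_subgroup (wAE v).
Proof.
split=> [|g h|g]; [by left| |by []].
by move=> [] g0 [] h0; rewrite /wAE /= g0 h0 ?vadd0 ?vadd0l ?vaddv; auto.
Qed.

Lemma wZ_subgroup v : is_subgroup (wZ v).
Proof.
split=> /=; first by split=> // x; rewrite !woneE1.
- move=> g h [g0 gv] [h0 hv]; split; first by rewrite wmulE2 g0 h0 vadd0.
  by move=> x; rewrite !wmulE1 g0 !vadd0 gv hv.
- move=> g [g0 gv]; split; first by rewrite winvE2.
  by move=> x; rewrite !winvE1 g0 !vadd0 gv.
Qed.

Variable q : nat.
Hypothesis q2 : (2 <= q)%N.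

(** A difference in direction v is invariant under v because 2v = 0, so commutators fall into
    [wZ v]; the difference of an invariant function vanishes, so [wZ v] commutes with [wAE v]. *)
Lemma wAE_nilpotent v : nilpotent_subgroups q (wAE v).
Proof.
apply: (@nilpotent_class2 _ q _ (wZ v)) => //.
- exact: wAE_subgroup.
- exact: wZ_subgroup.
- move=> g h gv hv; split; first exact: commgE2.
  move=> x; rewrite !commgE1.
  by case: gv => ->; case: hv => ->; rewrite ?vadd0 ?vaddK;
    move: (g.1 x) (h.1 x) (g.1 (vadd x v)) (h.1 (vadd x v)) => [] [] [] [].
- move=> g h [g0 gv] hv; apply: wreath_eq; last exact: commgE2.
  move=> x; rewrite commgE1 woneE1 g0 !vadd0.
  by case: hv => ->; rewrite ?vadd0 ?gv; case: (g.1 _); case: (h.1 _).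
Qed.

Lemma wA_nilpotent : nilpotent_subgroups q wA.
Proof.
suff -> : wA = wAE vzero by exact: wAE_nilpotent.
by apply/seteqP; split=> g; rewrite /wA /wAE /=; [left|case].
Qed.

Lemma wE_nilpotent : nilpotent_subgroups q wE.
Proof.
have cE g h : wE g -> wE h -> commg g h = 1%g.
  move=> gE hE; apply: wreath_eq; last exact: commgE2.
  by move=> x; rewrite commgE1 woneE1 !gE !hE.
apply: (@nilpotent_class2 _ q _ wE) => //; try exact: wE_subgroup.
by move=> g h gE hE; rewrite cE//; have [] := wE_subgroup.
Qed.

Lemma wreath_simply_connected (R : realType) :
  simply_connected R (coset_space R (@nilpotent_subgroups wreath q)).
Proof.
pose pa g : wreath := (g.1, vzero).
pose pe g : wreath := ([ffun=> false], g.2).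
apply: (@coset_space_simply_connected R wreath _ _ _ _ _ wA wE pa pe).
- exact: finite_finset.
- by move=> H [].
- apply: (@nilpotent_class2 _ q _ [set 1%g]) => //; try exact: is_subgroup1.
  + by move=> x y -> ->; rewrite /= comm1g.
  + by move=> x y -> _; rewrite comm1g.
- by move=> H H' nH [sH' _]; exact: nilpotent_subgroupsI.
- exact: wA_nilpotent.
- exact: wE_nilpotent.
- by [].
- by move=> g x; rewrite ffunE.
- move=> g; apply: wreath_eq; last by rewrite wmulE2 vadd0l.
  by move=> x; rewrite wmulE1 /= ffunE addbF.
- move=> g h g0 hE; apply: wreath_eq; last by rewrite g0.
  by move=> x; rewrite wmulE1 hE addbF.
- by move=> g h; rewrite /wA /= => g0 hE; rewrite g0 vadd0 vaddv.
- move=> h hE; exists (wAE h.2); split; first exact: wAE_nilpotent.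
  + by move=> g; left.
  + by right.
Qed.

End Wreath.

(** * Iterated commutators of monomials and the failure of nilpotency *)

Section NonNilpotent.
Variable q : nat.
Local Notation n := q.+1.

(* The monomial x_k x_(k+1) ... x_q, whose difference in direction k is the
   next one. *)
Definition monomial k : wreath n :=
  ([ffun x : {ffun 'I_n -> bool} => [forall i : 'I_n, (k <= i)%N ==> x i]],
   @vzero n).
Definition unit_shift k : wreath n :=
  ([ffun=> false], [ffun i : 'I_n => val i == k]).

(** Here the commutator is a difference in direction k. The monomial is x_k m with m free of x_k,
    and (x_k + 1) m + x_k m = m. For k = q the factor m is the empty product 1. *)
Lemma commg_monomial k : (k <= q)%N ->
  commg (monomial k) (unit_shift k) = monomial k.+1.
Proof.
move=> kq; apply: wreath_eq; last exact: commgE2.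
move=> x; rewrite commgE1 /= !ffunE !vadd0 !addFb addbF.
have kn : (k < n)%N by []; pose k0 := Ordinal kn.
set m := RHS.
have mon y : (forall i : 'I_n, (k < i)%N -> y i = x i) ->
    [forall i : 'I_n, (k <= i)%N ==> y i] = y k0 && m.
  move=> yx; rewrite /m; apply/forallP/andP => [H|[yk /forallP H] i].
    split; first by have := H k0; rewrite leqnn.
    apply/forallP => i; apply/implyP => ki; rewrite -yx//.
    by have := H i; rewrite ltnW.
  apply/implyP; rewrite leq_eqVlt => /orP[/eqP ki|ki].
    by have -> : i = k0 by exact: val_inj.
  by rewrite yx//; have := H i; rewrite ki.
rewrite !mon//; last first.
  by move=> i ki; rewrite !ffunE (gtn_eqF ki) addbF.
by rewrite !ffunE eqxx addbT; case: (x k0); case: m {mon}.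
Qed.

Lemma wreath_not_nilpotent : ~ nilpotent_class_le q [set: wreath n].
Proof.
move=> nil.
have L k : (k <= q)%N -> lower_central [set: wreath n] k (monomial k).
  elim: k => [//|k IH kq]; apply: sub_gen_smallest.
  exists (monomial k); first exact/IH/ltnW.
  by exists (unit_shift k) => //; apply: commg_monomial; exact: ltnW.
(* The element x_q of the term at index q is not trivial, as its value at the all-ones vector is
   1. *)
have := L q (leqnn q); rewrite nil /= => /(congr1 (fun g : wreath n =>
  g.1 [ffun=> true])); rewrite woneE1 ffunE => /forallP; apply=> i.
by rewrite ffunE implybT.
Qed.

End NonNilpotent.

Theorem mainTheorem6 (R : realType) (q : nat) (hq : (2 <= q)%N) :
  (exists G : groupType,
     ~ nilpotent_class_le q [set: G] /\
     simply_connected R (coset_space R (@nilpotent_subgroups G q))) /\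
  ~ (forall G : groupType,
       simply_connected R (coset_space R (@nilpotent_subgroups G q)) <->
       nilpotent_class_le q [set: G]).
Proof.
have nn := @wreath_not_nilpotent q.
have sc := @wreath_simply_connected q.+1 q hq R.
split; first by exists (wreath q.+1).
by move=> H; exact/nn/H.
Qed.
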